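(* Let $\Omega$ be a compact metric space, let $K$ be a kernel on $\Omega\times\Omega$ and let $C\in\mathbb R$ be such that $K+C$ is positive definite. Assume that $\mu\in\mathbb P(\Omega)$ is a $K$-invariant measure with full support, i.e. $U_K^\mu(x)=I_K(\mu)$ for all $x\in\Omega$ and $\operatorname{supp}(\mu)=\Omega$. Let $k\in L^2(\Omega\times\Omega,\mu\times\mu)$ be a symmetric function such that $$K(x,y)+C=\int_\Omega k(x,z)k(z,y)\,d\mu(z)\quad\text{for all }x,y\in\Omega.$$ Then for every measure $\nu\in\widetilde{\mathbb P}(\Omega)$, $$I_K(\nu)-I_K(\mu)=D^{2}_{L^2,k,\mu}(\nu).$$ In particular, for a discrete set $\omega_N=\{z_1,\dots,z_N\}\subset\Omega$, $$E_K(\omega_N)-I_K(\mu)=D^{2}_{L^2,k,\mu}(\omega_N).$$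
   Context: A kernel on $\Omega\times\Omega$ is a continuous symmetric function $K:\Omega\times\Omega\to\mathbb R$. $\mathcal M(\Omega)$ is the set of finite regular signed Borel measures on $\Omega$; $\mathbb P(\Omega)$ the Borel probability measures; $\widetilde{\mathbb P}(\Omega)$ the set of $\nu\in\mathcal M(\Omega)$ with $\nu(\Omega)=1$. $I_K(\mu)=\int_\Omega\int_\Omega K(x,y)\,d\mu(x)\,d\mu(y)$ and $U_K^\mu(x)=\int_\Omega K(x,y)\,d\mu(y)$. A kernel $L$ is positive definite if $I_L(\nu)\ge0$ for every $\nu\in\mathcal M(\Omega)$. The function $k$ is understood as an everywhere-defined real-valued Borel measurable function, square-integrable with respect to $\mu\times\mu$, with $k(x,y)=k(y,x)$. (A function $k$ as in the claim exists because $K+C$ is positive definite.) The $L^2$ discrepancy of $\nu$ relative to $\mu$ with respect to $k$ is $$D^2_{L^2,k,\mu}(\nu)=\int_\Omega\bigg|\int_\Omega k(x,y)\,d\nu(y)-\int_\Omega k(x,y)\,d\mu(y)\bigg|^2d\mu(x)=\int_\Omega\bigg|\int_\Omega k(x,y)\,d(\nu-\mu)(y)\bigg|^2d\mu(x),$$ where the inner integral is defined for $\mu$-a.e. $x$. For a finite set $\omega_N=\{z_1,\dots,z_N\}$, $D^2_{L^2,k,\mu}(\omega_N)=D^2_{L^2,k,\mu}\big(\frac1N\sum_{i=1}^N\delta_{z_i}\big)$ and $E_K(\omega_N)=\frac1{N^2}\sum_{i,j=1}^NK(z_i,z_j)$. *)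

(* Defs.v *)
From HB Require Import structures.
From mathcomp Require Import all_boot all_order all_algebra.
From mathcomp Require Import all_classical all_reals all_analysis.

Set Implicit Arguments.
Unset Strict Implicit.
Unset Printing Implicit Defensive.

Import Order.TTheory GRing.Theory Num.Theory.
Import numFieldNormedType.Exports.

Local Open Scope classical_set_scope.
Local Open Scope ring_scope.
Local Open Scope ereal_scope.

(* Measurable types are pointed in the library, so the sigma-algebra generated
   by the open sets needs a base point.  This excludes only the empty space,
   which carries no probability measure. *)
#[short(type="pmetricType")]
HB.structure Definition PointedMetric (K : numDomainType) :=
  {M of Pointed M & Metric K M}.

Notation borel T := (g_sigma_algebraType (@open T)).

(* A charge is a finite signed measure; a Hahn decomposition is chosen for each
   one.  The Jordan decomposition it yields does not depend on that choice
   (see cintegralE). *)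
Section charge_integral.
Context d (T : measurableType d) (R : realType).
Implicit Type nu : {charge set T -> \bar R}.

Definition hahn_posset nu : set T := sval (cid (Hahn_decomposition nu)).

Definition hahn_negset nu : set T := sval (cid (svalP (cid (Hahn_decomposition nu)))).

Lemma hahn_setsP nu : hahn_decomposition nu (hahn_posset nu) (hahn_negset nu).
Proof. exact: (svalP (cid (svalP (cid (Hahn_decomposition nu))))). Qed.

Definition total_variation nu : set T -> \bar R := charge_variation (hahn_setsP nu).

(* If a measurable f is not nu-integrable then one of the two terms is infinite, and so is
   the value, because +oo - +oo = -oo in \bar R. *)
Definition cintegral nu (f : T -> \bar R) : \bar R :=
  \int[jordan_pos (hahn_setsP nu)]_x f x - \int[jordan_neg (hahn_setsP nu)]_x f x.

Lemma cintegralE nu (P N : set T) (nuPN : hahn_decomposition nu P N) f :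
  cintegral nu f = \int[jordan_pos nuPN]_x f x - \int[jordan_neg nuPN]_x f x.
Proof.
have uniq := Hahn_decomposition_uniq (hahn_setsP nu) nuPN.
congr (_ - _); apply: eq_measure_integral => A mA _.
- rewrite /= !jordan_posE !cjordan_posE /crestr0 mem_set// /crestr.
  by have [-> _] := uniq _ mA.
- rewrite /= !jordan_negE !cjordan_negE /crestr0 mem_set// /crestr.
  by have [_ ->] := uniq _ mA.
Qed.

Lemma cintegral_measure (mu : {finite_measure set T -> \bar R}) f :
  cintegral (charge_of_finite_measure mu) f = \int[mu]_x f x.
Proof.
have muTP : hahn_decomposition (charge_of_finite_measure mu) setT set0.
  split; [split=> // | split=> // | by rewrite setU0 | by rewrite setI0].
  by move=> A mA; rewrite subset0 => ->; rewrite charge0.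
rewrite (cintegralE muTP) (@eq_measure_integral _ _ _ _ mu); last first.
  move=> A mA _; rewrite /= jordan_posE cjordan_posE /crestr0 mem_set// /crestr.
  by rewrite setIT.
rewrite (_ : \int[jordan_neg muTP]_x f x = 0) ?sube0//.
rewrite (@eq_measure_integral _ _ _ _ mzero) ?integral_measure_zero//.
move=> A mA _; rewrite /= jordan_negE cjordan_negE /crestr0 mem_set// /crestr.
by rewrite setI0 charge0 oppe0.
Qed.

End charge_integral.

Section kernels.
Context (R : realType) (Omega : pmetricType R).
Implicit Types (K k : Omega -> Omega -> R) (mu : probability (borel Omega) R)
  (nu : {charge set (borel Omega) -> \bar R}).

(* Regularity in the sense of Rudin: that of the total variation. *)
Definition regular_charge nu : Prop :=
  forall A : set (borel Omega), measurable A ->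
    total_variation nu A =
      ereal_inf [set total_variation nu U | U in [set U : set Omega | open U /\ A `<=` U]] /\
    total_variation nu A =
      ereal_sup [set total_variation nu F | F in [set F : set Omega | compact F /\ F `<=` A]].

(* The members of \widetilde P(Omega). *)
Definition normalized_charge nu : Prop := regular_charge nu /\ nu [set: Omega] = 1.

Definition msupport mu : set Omega :=
  [set x | forall U : set Omega, open U -> U x -> 0 < mu U].

Definition is_kernel K : Prop :=
  continuous (fun p : Omega * Omega => K p.1 p.2) /\ (forall x y, K x y = K y x).

Definition potential K nu (x : Omega) : \bar R := cintegral nu (fun y => (K x y)%:E).

Definition energy K nu : \bar R := cintegral nu (potential K nu).

Definition positive_definite K : Prop := forall nu, regular_charge nu -> 0 <= energy K nu.

Definition invariant_measure K mu : Prop :=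
  forall x, potential K (charge_of_finite_measure mu) x = energy K (charge_of_finite_measure mu).

(* The outer integrand is +oo wherever k x is not nu-integrable: a finite
   discrepancy means that the inner integrals exist for mu-almost every x. *)
Definition L2_discrepancy k mu nu : \bar R :=
  \int[mu]_x (`| cintegral nu (fun y => (k x y)%:E) - \int[mu]_y (k x y)%:E | ^+ 2).

Definition discrete_energy K (N : nat) (z : 'I_N -> Omega) : R :=
  ((N%:R ^+ 2)^-1 * \sum_(i < N) \sum_(j < N) K (z i) (z j))%R.

Definition empirical (N : nat) (z : 'I_N -> Omega) (A : set (borel Omega)) : \bar R :=
  (N%:R^-1)%:E * \sum_(i < N) \d_(z i : borel Omega) A.

End kernels.

Section empirical_charge.
Context (R : realType) (Omega : pmetricType R) (N : nat) (z : 'I_N -> Omega).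

Let m (n : nat) : {measure set (borel Omega) -> \bar R} :=
  if insub n is Some i then \d_(z i : borel Omega) else mzero.

Let c : {nonneg R} := ((N%:R^-1)%:nng)%R.

Let empiricalE : @empirical R Omega N z = mscale c (msum m N).
Proof.
apply/funext => A; rewrite /empirical /mscale /msum /=; congr (_ * _).
by apply: eq_bigr => i _; rewrite /m valK.
Qed.

Let empirical0 : @empirical R Omega N z set0 = 0.
Proof. by rewrite empiricalE measure0. Qed.

Let empirical_fin (A : set (borel Omega)) : measurable A -> @empirical R Omega N z A \is a fin_num.
Proof.
move=> _; rewrite /empirical fin_numM// sum_fin_num; apply/allP => _ /mapP[i _ ->].
by rewrite /dirac.
Qed.

Let empirical_sigma_additive : semi_sigma_additive (@empirical R Omega N z).
Proof. rewrite empiricalE; exact: measure_semi_sigma_additive. Qed.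

HB.instance Definition _ := isCharge.Build _ (borel Omega) R (@empirical R Omega N z)
  empirical0 empirical_fin empirical_sigma_additive.

End empirical_charge.

(* Main.v *)
Require Import Defs.
From HB Require Import structures.
From mathcomp Require Import all_boot all_order all_algebra.
From mathcomp Require Import all_classical all_reals all_analysis.
From mathcomp Require Import measurable_realfun.
From mathcomp Require Import ring lra.

Set Implicit Arguments.
Unset Strict Implicit.
Unset Printing Implicit Defensive.

Import Order.TTheory GRing.Theory Num.Theory.
Import numFieldNormedType.Exports.

Local Open Scope classical_set_scope.
Local Open Scope ring_scope.
Local Open Scope ereal_scope.

(** Write L for K + C.  The root formula says that L x y is the inner product in
L^2(mu) of the sections k(., x) and k(., y): L is the Gram kernel of the feature
map x |-> k(., x).  Integrating against finite measures a and b gives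

  int int L(x, y) da(x) db(y) = int k_a(z) k_b(z) dmu(z),
  where k_a(z) = int k(z, x) da(x),

so the L-energy of a combination of measures is the square of the L^2(mu)-norm
of the same combination of the feature means k_a ([integral_feature_mean_sqr]).
The interchange of integrals is legitimate because the sections are bounded in
L^2(mu): the square of the norm of k(., x) is L(x, x), and K is continuous on a
compact space, so that |k(z, x) k(z, y)| is integrable for a x b x mu.

Take the combination nu - mu = nu^+ - nu^- - mu.  Its feature mean is, almost
everywhere, the integrand of the discrepancy, and its L-energy is

  I_L(nu) - 2 int U_L^mu dnu + I_L(mu).

Invariance makes U_L^mu constant, equal to I_L(mu), and nu has mass 1, so this is
I_L(nu) - I_L(mu).  The constant C contributes the same to both energies and
drops out, which leaves I_K(nu) - I_K(mu) ([energy_sub_discrepancy]).  The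
discrete case is the one where nu is an empirical measure: its energy is the
double sum ([energy_empirical]). *)

(** * Sections and products of measures *)

(** Here f is of arbitrary sign and need not be integrable: the positive and the
    negative part are treated separately by Tonelli's theorem. *)
Lemma measurable_fun_integral_section d1 d2 (T1 : measurableType d1)
  (T2 : measurableType d2) (R : realType) (m : {sigma_finite_measure set T2 -> \bar R})
  (f : T1 * T2 -> \bar R) : measurable_fun setT f ->
  measurable_fun setT (fun x => \int[m]_y f (x, y)).
Proof.
move=> mf.
have -> : (fun x => \int[m]_y f (x, y)) =
    fubini_F m (fun p => f^\+ p) \- fubini_F m (fun p => f^\- p).
  apply/funext => x; rewrite [LHS]integralE.
  by congr (_ - _); apply: eq_integral => y _; rewrite ?funeposE ?funenegE.
apply: emeasurable_funB; apply: measurable_fun_fubini_tonelli_F => //.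
- exact: measurable_funepos mf.
- exact: measurable_funeneg mf.
Qed.

Lemma integrable_fubini_G d1 d2 (T1 : measurableType d1)
  (T2 : measurableType d2) (R : realType) (m1 : {sigma_finite_measure set T1 -> \bar R})
  (m2 : {sigma_finite_measure set T2 -> \bar R}) (f : T1 * T2 -> \bar R) :
  (m1 \x m2).-integrable setT f -> m2.-integrable setT (fubini_G m1 f).
Proof.
move=> intf; have mf := measurable_int _ intf.
have mabs : measurable_fun setT (abse \o f) by exact: measurableT_comp.
apply/integrableP; split; first exact: measurable_fubini_G intf.
apply: le_lt_trans ((integrable21ltyP m1 m2 mf).1 intf).
apply: ge0_le_integral => //.
- by apply: measurableT_comp => //; exact: measurable_fubini_G intf.
- by apply: (measurable_fun_fubini_tonelli_G (abse \o f)) => //= p; exact: abse_ge0.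
- move=> y _; apply: le_abse_integral => //.
  exact: (measurableT_comp mf (pair2_measurable y)).
Qed.

Section finite_product.
Context d1 d2 (T1 : measurableType d1) (T2 : measurableType d2) (R : realType).
Variables (a : {finite_measure set T1 -> \bar R}) (b : {finite_measure set T2 -> \bar R}).

(** A name of its own for the product measure, which carries the fact that a
    product of finite measures is finite, hence sigma-finite: Fubini's theorem is
    applied to the product of this measure with a third one. *)
Definition finite_product : set (T1 * T2) -> \bar R := a \x b.

HB.instance Definition _ := Measure.on finite_product.

Let finite_product_fin : fin_num_fun finite_product.
Proof.
apply: lty_fin_num_fun; rewrite -setXTT.
rewrite -[X in X < _]/((a \x b) (setT `*` setT)) product_measure1E//.
by rewrite ltey_eq fin_numM// fin_num_measure.
Qed.

HB.instance Definition _ :=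
  Measure_isFinite.Build _ _ _ finite_product finite_product_fin.

End finite_product.

(** * Gram kernels and means of a feature map *)

Section feature_map.
Context d d' (Z : measurableType d) (X : measurableType d') (R : realType).
Variables (mu : {sigma_finite_measure set Z -> \bar R}) (phi : Z -> X -> R) (B : R).
Hypothesis mphi : measurable_fun setT (fun p : Z * X => phi p.1 p.2).
Hypothesis phi_bnd : forall x, \int[mu]_z (phi z x ^+ 2)%:E <= B%:E.
Implicit Types a b : {finite_measure set X -> \bar R}.

(** The inner product of the features phi(., x) and phi(., y) in L^2(mu). *)
Definition gram x y : \bar R := \int[mu]_z (phi z x * phi z y)%:E.

Definition feature_mean a z : \bar R := \int[a]_x (phi z x)%:E.

Let mphil x : measurable_fun setT (phi ^~ x).
Proof. exact: (measurableT_comp mphi (measurable_pair2 _)). Qed.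

Let mphir z : measurable_fun setT (phi z).
Proof. exact: (measurableT_comp mphi (pair1_measurable _)). Qed.

Lemma measurable_feature_mean a : measurable_fun setT (feature_mean a).
Proof.
apply: (@measurable_fun_integral_section _ _ _ _ _ a (fun p => (phi p.1 p.2)%:E)).
exact/measurable_EFinP.
Qed.

(** |s t| <= s^2 + t^2 is enough here, and avoids the Cauchy-Schwarz inequality:
    only finiteness, uniform in x and y, matters. *)
Lemma feature_product_bound x y :
  \int[mu]_z `|(phi z x * phi z y)%:E| <= (B + B)%:E.
Proof.
have m2 u : measurable_fun setT (fun z => (phi z u ^+ 2)%:E).
  by apply/measurable_EFinP; apply: measurable_funX.
rewrite EFinD; apply: le_trans (leeD (phi_bnd x) (phi_bnd y)).
rewrite -ge0_integralD//=; last 2 first.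
- by move=> z _; rewrite lee_fin sqr_ge0.
- by move=> z _; rewrite lee_fin sqr_ge0.
apply: ge0_le_integral => //=.
- apply/measurable_EFinP; apply: measurableT_comp => //.
  exact: measurable_funM.
- exact: emeasurable_funD.
move=> z _; rewrite lee_fin normrM -[(phi z x ^+ 2)%R]real_normK ?num_real//.
rewrite -[(phi z y ^+ 2)%R]real_normK ?num_real//.
move: (normr_ge0 (phi z x)) (normr_ge0 (phi z y)).
set s := `|phi z x|%R; set t := `|phi z y|%R; nra.
Qed.

Let feature_product (p : (X * X) * Z) : \bar R := (phi p.2 p.1.1 * phi p.2 p.1.2)%:E.

Let measurable_feature_product : measurable_fun setT feature_product.
Proof.
apply/measurable_EFinP; apply: measurable_funM.
- exact: (measurableT_comp mphi (measurable_fun_pair measurable_snd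
    (measurableT_comp measurable_fst measurable_fst))).
- exact: (measurableT_comp mphi (measurable_fun_pair measurable_snd
    (measurableT_comp measurable_snd measurable_fst))).
Qed.

(** This is what licenses all later interchanges of integrals: the inner integral
    over z is bounded by a constant, and a x b is finite. *)
Lemma integrable_feature_product a b :
  (finite_product a b \x mu).-integrable setT feature_product.
Proof.
apply/(integrable12ltyP (finite_product a b) mu measurable_feature_product).
have : \int[finite_product a b]_p (B + B)%:E < +oo.
  rewrite integral_cst//= lte_mul_pinfty ?lee_fin//.
    rewrite -lee_fin; apply: le_trans (feature_product_bound point point).
    exact: integral_ge0.
  by rewrite -ge0_fin_numE// fin_num_measure.
apply: le_lt_trans; apply: ge0_le_integral => //=.
- by move=> p _; exact: integral_ge0.
- apply: (@measurable_fun_integral_section _ _ _ _ _ mu (fun p => `|feature_product p|)).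
  exact: measurableT_comp.
- by move=> p _; exact: feature_product_bound.
Qed.

Lemma measurable_gram : measurable_fun setT (fun p : X * X => gram p.1 p.2).
Proof.
exact: (@measurable_fun_integral_section _ _ _ _ _ mu feature_product).
Qed.

Lemma integrable_gram a b :
  (finite_product a b).-integrable setT (fun p => gram p.1 p.2).
Proof. exact: integrable_fubini_F (integrable_feature_product a b). Qed.

Lemma integrable_gram_section b x : b.-integrable setT (gram x).
Proof.
have mg : measurable_fun setT (gram x).
  exact: (measurableT_comp measurable_gram (pair1_measurable x)).
apply: le_integrable (finite_measure_integrable_cst b (B + B)%R measurableT) => //.
move=> y _; apply: le_trans (le_abse_integral mu measurableT _) _.
  by apply/measurable_EFinP; exact: measurable_funM.
by apply: le_trans (feature_product_bound x y) _; rewrite /= lee_fin ler_norm.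
Qed.

Lemma gram_energy_fin_num a b : \int[a]_x \int[b]_y gram x y \is a fin_num.
Proof.
apply: integrable_fin_num => //.
exact: integrable_fubini_F (integrable_gram a b).
Qed.

(** The square of phi is integrable for a x mu by the uniform L^2(mu) bound, so by
    Fubini almost every phi(z, .) is square-integrable for the finite measure a,
    and therefore integrable since |s| <= 1 + s^2. *)
Lemma ae_integrable_feature a :
  {ae mu, forall z, a.-integrable setT (fun x => (phi z x)%:E)}.
Proof.
have isq : (a \x mu).-integrable setT (fun p => (phi p.2 p.1 ^+ 2)%:E).
  have msq : measurable_fun setT (fun p : X * Z => (phi p.2 p.1 ^+ 2)%:E).
    apply/measurable_EFinP; apply: measurable_funX.
    exact: (measurableT_comp mphi (measurable_fun_pair measurable_snd measurable_fst)).
  apply/integrable12ltyP => //.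
  have : \int[a]_p B%:E < +oo.
    rewrite integral_cst//= lte_mul_pinfty ?lee_fin//.
      rewrite -lee_fin; apply: le_trans (phi_bnd point).
      by apply: integral_ge0 => z _; rewrite lee_fin sqr_ge0.
    by rewrite -ge0_fin_numE// fin_num_measure.
  apply: le_lt_trans; apply: ge0_le_integral => //=.
  - by move=> p _; exact: integral_ge0.
  - apply: (@measurable_fun_integral_section _ _ _ _ _ mu
      (fun p => `|(phi p.2 p.1 ^+ 2)%:E|)).
    exact: measurableT_comp.
  - move=> p _; apply: le_trans (phi_bnd p); rewrite le_eqVlt; apply/orP; left.
    by apply/eqP; apply: eq_integral => z _; rewrite ger0_norm// sqr_ge0.
apply: filterS (ae_integrable2 isq) => z isz.
have i1 : a.-integrable setT (fun x => (1 + phi z x ^+ 2)%:E).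
  apply: (@eq_integrable _ _ _ _ _ _ ((EFin \o cst 1%R) \+ (fun x => (phi z x ^+ 2)%:E))) => //.
  by apply: integrableD => //; exact: finite_measure_integrable_cst.
apply: le_integrable i1 => //; first exact/measurable_EFinP.
move=> x _ /=; rewrite lee_fin [leRHS]ger0_norm ?addr_ge0 ?sqr_ge0//.
rewrite -[(phi z x ^+ 2)%R]real_normK ?num_real//.
set s := `|phi z x|%R; move: (sqr_ge0 (s - 1)%R) (sqr_ge0 s); nra.
Qed.

(** Fubini on a x b for fixed z.  It can fail on a mu-null set of z, where the
    feature means are given by divergent integrals. *)
Lemma ae_feature_mean_mul a b : {ae mu, forall z,
  \int[finite_product a b]_p (phi z p.1 * phi z p.2)%:E =
  feature_mean a z * feature_mean b z}.
Proof.
apply: filterS3 (ae_integrable_feature a) (ae_integrable_feature b)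
  (ae_integrable2 (integrable_feature_product a b)) => z ia ib iab.
rewrite -(integral12_prod_meas1 iab)/= /fubini_F.
transitivity (\int[a]_x ((phi z x)%:E * feature_mean b z)).
  by apply: eq_integral => x _; rewrite -integralZl.
have /fineK <- : feature_mean b z \is a fin_num by exact: integrable_fin_num.
by rewrite integralZr.
Qed.

Lemma integrable_feature_mean_mul a b :
  mu.-integrable setT (fun z => feature_mean a z * feature_mean b z).
Proof.
have ig := integrable_fubini_G (integrable_feature_product a b).
apply/integrableP; split.
  by apply: emeasurable_funM; exact: measurable_feature_mean.
have /integrableP[mG] := ig; apply: le_lt_trans.
rewrite le_eqVlt; apply/orP; left; apply/eqP; apply: ae_eq_integral => //=.
- apply: measurableT_comp => //.
  by apply: emeasurable_funM; exact: measurable_feature_mean.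
- exact: measurableT_comp.
by apply: filterS (ae_feature_mean_mul a b) => z /= <-.
Qed.

(** The factorization of the Gram energy: integrating phi(z, x) phi(z, y) over z
    first gives the Gram kernel, integrating over (x, y) first gives the product
    of the feature means. *)
Lemma integral_feature_mean_mul a b :
  \int[mu]_z (feature_mean a z * feature_mean b z) = \int[a]_x \int[b]_y gram x y.
Proof.
have iab := integrable_feature_product a b.
rewrite (@integral12_prod_meas1 _ _ _ _ _ a b (fun p => gram p.1 p.2)); last first.
  exact: integrable_gram.
rewrite -[RHS]/(\int[finite_product a b]_p \int[mu]_z feature_product (p, z)) (Fubini iab).
apply: ae_eq_integral => //.
- by apply: emeasurable_funM; exact: measurable_feature_mean.
- exact: (measurable_fubini_G iab).
by apply: filterS (ae_feature_mean_mul a b) => z ->.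
Qed.

Lemma ae_feature_mean_fin_num a : {ae mu, forall z, feature_mean a z \is a fin_num}.
Proof.
apply: filterS (ae_integrable_feature a) => z iz.
exact: integrable_fin_num.
Qed.

Lemma gram_energyC a b :
  \int[a]_x \int[b]_y gram x y = \int[b]_x \int[a]_y gram x y.
Proof.
by rewrite -!integral_feature_mean_mul; apply: eq_integral => z _; rewrite muleC.
Qed.

(** The Gram energy of the signed combination of the measures m_i with weights
    c_i.  Passing to real values with fine changes nothing almost everywhere, as
    the means are almost everywhere finite. *)
Lemma integral_feature_mean_sqr n (c : 'I_n -> R)
    (m : 'I_n -> {finite_measure set X -> \bar R}) :
  \int[mu]_z ((\sum_i c i * fine (feature_mean (m i) z))%R ^+ 2)%:E =
  \sum_i \sum_j (c i * c j)%:E * \int[m i]_x \int[m j]_y gram x y.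
Proof.
have ae_fin : {ae mu, forall z, forall i, feature_mean (m i) z \is a fin_num}.
  exact: filter_forall (fun i => ae_feature_mean_fin_num (m i)).
transitivity (\int[mu]_z (\sum_i \sum_j
    (c i * c j)%:E * (feature_mean (m i) z * feature_mean (m j) z))).
  apply: ae_eq_integral => //.
  - apply/measurable_EFinP; apply: measurable_funX.
    apply: measurable_sum => i; apply: measurable_funM => //.
    by apply: measurableT_comp => //; exact: measurable_feature_mean.
  - apply: emeasurable_sum => i; apply: emeasurable_sum => j.
    apply: measurable_funeM.
    by apply: emeasurable_funM; exact: measurable_feature_mean.
  apply: filterS ae_fin => z fin_z _.
  rewrite expr2 big_distrlr/= -sumEFin; apply: eq_bigr => i _.
  rewrite -sumEFin; apply: eq_bigr => j _.
  by rewrite mulrACA EFinM [in X in _ * X]EFinM !fineK.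
rewrite integral_sum//; last first.
  move=> i; apply: integrable_sum => // j _; apply: integrableZl => //.
  exact: integrable_feature_mean_mul.
apply: eq_bigr => i _; rewrite integral_sum//; last first.
  by move=> j; apply: integrableZl => //; exact: integrable_feature_mean_mul.
apply: eq_bigr => j _; rewrite integralZl ?integral_feature_mean_mul//.
exact: integrable_feature_mean_mul.
Qed.
End feature_map.

(** * Integrals against charges *)

(** The pair (setT, set0) is a Hahn decomposition of a nonnegative charge, so the
    negative part contributes nothing. *)
Lemma cintegral_eq_measure d (T : measurableType d) (R : realType)
    (nu : {charge set T -> \bar R}) (m : {measure set T -> \bar R}) f :
  (forall A, measurable A -> nu A = m A) -> cintegral nu f = \int[m]_x f x.
Proof.
move=> num.
have nuTP : hahn_decomposition nu setT set0.
  split; [split=> // A mA _|split=> // A mA|by rewrite setU0|by rewrite setI0].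
  - by rewrite num.
  - by rewrite subset0 => ->; rewrite charge0.
rewrite (cintegralE nuTP).
rewrite (@eq_measure_integral _ _ _ _ m); last first.
  move=> A mA _; rewrite /= jordan_posE cjordan_posE /crestr0 mem_set// /crestr.
  by rewrite setIT num.
rewrite (@eq_measure_integral _ _ _ _ mzero (jordan_neg nuTP)); last first.
  move=> A mA _; rewrite /= jordan_negE cjordan_negE /crestr0 mem_set// /crestr.
  by rewrite setI0 charge0 oppe0.
by rewrite integral_measure_zero sube0.
Qed.

(** The empirical charge is a scaled sum of Dirac measures, and integrating
    against such a sum is additive for the nonnegative functions f^+ and f^-. *)
Lemma cintegral_empirical (R : realType) (Omega : pmetricType R) (N : nat)
    (z : 'I_N -> Omega) (f : Omega -> R) :
  measurable_fun setT (f : borel Omega -> R) ->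
  cintegral (empirical z) (EFin \o f) = (N%:R^-1 * \sum_i f (z i))%:E.
Proof.
move=> mf.
have Nge0 : (0 <= N%:R^-1 :> R)%R by rewrite invr_ge0.
pose c := NngNum Nge0.
pose dz (n : nat) : {measure set (borel Omega) -> \bar R} :=
  if insub n is Some i then \d_(z i : borel Omega) else mzero.
rewrite (@cintegral_eq_measure _ _ _ _ (mscale c (msum dz N))); last first.
  move=> A _; congr (_ * _); apply: eq_bigr => i _.
  by rewrite /dz valK.
have intE (g : borel Omega -> \bar R) : measurable_fun setT g -> (forall x, 0 <= g x) ->
    \int[mscale c (msum dz N)]_x g x = (N%:R^-1)%:E * \sum_i g (z i).
  move=> mg g0.
  rewrite ge0_integral_mscale// ge0_integral_measure_sum//; congr (_ * _).
  apply: eq_bigr => i _.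
  by rewrite /dz valK integral_dirac// diracT mul1e.
rewrite integralE funerpos funerneg !intE.
- rewrite !sumEFin -!EFinM -EFinB -mulrBr -sumrB.
  by congr (_ * _)%:E; apply: eq_bigr => i _; rewrite -[in RHS](funrposBneg f).
- by apply/measurable_EFinP; exact: measurable_funrneg.
- by move=> x; rewrite lee_fin funrneg_ge0.
- by apply/measurable_EFinP; exact: measurable_funrpos.
- by move=> x; rewrite lee_fin funrpos_ge0.
Qed.

Lemma empirical_setT (R : realType) (Omega : pmetricType R) (N : nat)
  (z : 'I_N -> Omega) : (0 < N)%N -> empirical z setT = 1.
Proof.
move=> N0; rewrite /empirical; under eq_bigr do rewrite diracT.
by rewrite sumEFin -EFinM sumr_const card_ord mulVf// pnatr_eq0 -lt0n.
Qed.

(** * Energy and discrepancy on a compact metric space *)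

Lemma kernel_diag_bounded (R : realType) (Omega : pmetricType R)
    (K : Omega -> Omega -> R) :
  compact [set: Omega] -> is_kernel K -> exists B, forall x, (K x x <= B)%R.
Proof.
move=> Oc [Kc _].
have [||x _ xmax] := @compact_EVT_max Omega R (fun x => K x x) setT _ Oc _.
- by exists point.
- apply: continuous_subspaceT => x.
  apply: (@continuous_comp _ _ _ (fun x => (x, x)) (fun p => K p.1 p.2)); last exact: Kc.
  exact: cvg_pair cvg_id cvg_id.
- by exists (K x x) => y; apply: xmax; rewrite inE.
Qed.

Section main.
Context (R : realType) (Omega : pmetricType R).
Variables (K k : Omega -> Omega -> R) (C B : R) (mu : probability (borel Omega) R).
Hypothesis mk : measurable_fun setT (fun p : borel Omega * borel Omega => k p.1 p.2).
Hypothesis k_sym : forall x y, k x y = k y x.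
Hypothesis k_root : forall x y, (K x y + C)%:E = \int[mu]_z (k x z * k z y)%:E.
Hypothesis K_bnd : forall x, (K x x + C <= B)%R.
Implicit Types (nu : {charge set (borel Omega) -> \bar R})
  (a b : {finite_measure set (borel Omega) -> \bar R}).

Let T := borel Omega.
Let phi : T -> T -> R := k.

(** The symmetry of k turns the root formula into the statement that K + C is the
    Gram kernel of k. *)
Let gramE x y : gram mu phi x y = (K x y + C)%:E.
Proof. by rewrite k_root; apply: eq_integral => z _; rewrite /phi (k_sym z x). Qed.

Let phi_bnd x : \int[mu]_z (phi z x ^+ 2)%:E <= B%:E.
Proof.
apply: le_trans (_ : (K x x + C)%:E <= _); last by rewrite lee_fin.
rewrite k_root le_eqVlt; apply/orP; left; apply/eqP; apply: eq_integral => z _.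
by rewrite expr2 /phi (k_sym x z).
Qed.

Let gram_en a b : R := fine (\int[a]_x \int[b]_y gram mu phi x y).

Let gram_enE a b : \int[a]_x \int[b]_y gram mu phi x y = (gram_en a b)%:E.
Proof. by rewrite fineK// (gram_energy_fin_num mk phi_bnd). Qed.

Let gram_enC a b : gram_en a b = gram_en b a.
Proof. by rewrite /gram_en (gram_energyC mk phi_bnd). Qed.

(** K inherits its measurability from the Gram kernel. *)
Let measurable_kernel x : measurable_fun setT (K x : T -> R).
Proof.
have mg : measurable_fun setT (fun y : T => (K x y + C)%:E).
  under eq_fun do rewrite -gramE.
  exact: measurable_int _ (integrable_gram_section mk phi_bnd mu x).
rewrite (_ : K x = fun y => (K x y + C - C)%R); last first.
  by apply/funext => y; rewrite addrK.
by apply: measurable_funB => //; exact/measurable_EFinP.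
Qed.

Let integral_K a x :
  \int[a]_y (K x y)%:E = \int[a]_y gram mu phi x y - (C * fine (a setT))%:E.
Proof.
have ig := integrable_gram_section mk phi_bnd a x.
rewrite EFinM fineK ?fin_num_measure// -integral_cst// -integralB//.
  by apply: eq_integral => y _ /=; rewrite gramE -EFinB addrK.
exact: finite_measure_integrable_cst.
Qed.

Let mass_mu : fine ((mu : {finite_measure set (borel Omega) -> \bar R}) setT) = 1%R.
Proof. by rewrite -[RHS]/(fine 1) -(probability_setT mu). Qed.

Let gram_pot a x : \bar R := \int[a]_y gram mu phi x y.

Let gram_pot_fin a x : gram_pot a x \is a fin_num.
Proof. exact: integrable_fin_num (integrable_gram_section mk phi_bnd a x). Qed.

Let integrable_gram_pot a b : a.-integrable setT (gram_pot b).
Proof. exact: integrable_fubini_F (integrable_gram mk phi_bnd a b). Qed.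

(** Invariance of mu for K is invariance for the Gram kernel, because U_K^mu and
    the Gram potential of mu differ by a constant. *)
Let invariant_gram_en a : invariant_measure K mu ->
  gram_en a mu = (gram_en mu mu * fine (a setT))%R.
Proof.
move=> inv; pose c := fine (gram_pot mu point).
have gram_pot_mu x : gram_pot mu x = c%:E.
  have := inv x; rewrite -(inv point) /potential !cintegral_measure !integral_K.
  rewrite -!/(gram_pot mu _) /c.
  move: (gram_pot mu x) (gram_pot mu point)
    (gram_pot_fin mu x) (gram_pot_fin mu point) => [u||] [v||]// _ _.
  by rewrite -!EFinB => -[/addIr ->].
have enc b : gram_en b mu = (c * fine (b setT))%R.
  rewrite /gram_en; under eq_integral do rewrite -/(gram_pot mu _) gram_pot_mu.
  by rewrite integral_cst// fineM ?fin_num_measure.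
rewrite !enc -[in LHS](mulr1 c); congr (_ * _ * _)%R.
exact/esym/mass_mu.
Qed.

Let energy_mu : energy K (charge_of_finite_measure mu) = (gram_en mu mu - C)%:E.
Proof.
rewrite /energy cintegral_measure.
transitivity (\int[mu]_x (gram_pot mu x - C%:E)).
  apply: eq_integral => x _.
  by rewrite /potential cintegral_measure integral_K mass_mu mulr1.
rewrite integralB//; [|exact: integrable_gram_pot|exact: finite_measure_integrable_cst].
rewrite EFinB; congr (_ - _); first exact: gram_enE.
by rewrite integral_cst// -[RHS]mule1; congr (_ * _); exact: probability_setT.
Qed.

Let p nu := jordan_pos (hahn_setsP nu).
Let n nu := jordan_neg (hahn_setsP nu).

Let charge_setT nu : nu setT = 1 -> fine (p nu setT) = (fine (n nu setT) + 1)%R.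
Proof.
move=> nu1; have := jordan_decomp (hahn_setsP nu) measurableT.
rewrite nu1 /cadd/= cscaleN1/= => /esym.
rewrite -[jordan_pos _ _]fineK ?fin_num_measure//.
rewrite -[jordan_neg _ _]fineK ?fin_num_measure//.
by rewrite -EFinB => -[<-]; rewrite addrC subrK.
Qed.

(** When nu has mass 1, its potential for K is its Gram potential minus C. *)
Let integral_potential nu a : nu setT = 1 -> \int[a]_x potential K nu x =
  (gram_en a (p nu) - gram_en a (n nu) - C * fine (a setT))%:E.
Proof.
move=> nu1.
transitivity (\int[a]_x ((gram_pot (p nu) x - gram_pot (n nu) x) - C%:E)).
  apply: eq_integral => x _.
  rewrite /potential /cintegral (integral_K (p nu)) (integral_K (n nu)).
  rewrite -/(gram_pot (p nu) x) -/(gram_pot (n nu) x).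
  rewrite -(fineK (gram_pot_fin (p nu) x)) -(fineK (gram_pot_fin (n nu) x)).
  rewrite -!EFinB; congr _%:E; rewrite (charge_setT nu1); ring.
rewrite integralB//; [|by apply: integrableB => //; exact: integrable_gram_pot
                        |exact: finite_measure_integrable_cst].
rewrite integralB//; [|exact: integrable_gram_pot|exact: integrable_gram_pot].
rewrite integral_cst// !gram_enE.
by rewrite -[X in _ * X]fineK ?fin_num_measure// -EFinM -!EFinB.
Qed.

Let energy_charge nu : nu setT = 1 -> energy K nu =
  (gram_en (p nu) (p nu) - gram_en (p nu) (n nu)
   - gram_en (n nu) (p nu) + gram_en (n nu) (n nu) - C)%:E.
Proof.
move=> nu1; rewrite /energy /cintegral.
rewrite (integral_potential (p nu) nu1) (integral_potential (n nu) nu1) -EFinB.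
congr _%:E; rewrite (charge_setT nu1); ring.
Qed.

(** The discrepancy is the Gram energy of nu^+ - nu^- - mu. *)
Let discrepancy_gram nu : L2_discrepancy k mu nu =
  (gram_en (p nu) (p nu) + gram_en (n nu) (n nu) + gram_en mu mu
   - 2 * gram_en (p nu) (n nu) - 2 * gram_en (p nu) mu + 2 * gram_en (n nu) mu)%:E.
Proof.
(* The weights of nu^+, nu^- and mu in nu - mu. *)
pose c (i : 'I_3) : R := if i == ord0 then 1%R else (-1)%R.
pose m (i : 'I_3) : {finite_measure set T -> \bar R} :=
  match val i with 0%N => p nu | 1%N => n nu | _ => mu end.
transitivity (\int[mu]_z ((\sum_i c i * fine (feature_mean phi (m i) z))%R ^+ 2)%:E).
  have mF a := measurable_feature_mean mk a.
  apply: ae_eq_integral => //.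
  - have mabs : measurable_fun setT (fun z : T =>
        `|cintegral nu (fun y => (k z y)%:E) - \int[mu]_y (k z y)%:E|).
      apply: measurableT_comp => //.
      by apply: emeasurable_funB; [apply: emeasurable_funB|]; exact: mF.
    by under eq_fun do rewrite expe2; exact: emeasurable_funM.
  - apply/measurable_EFinP; apply: measurable_funX.
    apply: measurable_sum => i; apply: measurable_funM => //.
    by apply: measurableT_comp => //; exact: mF.
  have fF a := ae_feature_mean_fin_num mk phi_bnd a.
  apply: filterS3 (fF (p nu)) (fF (n nu)) (fF mu) => z fp fn fm _.
  rewrite !big_ord_recl big_ord0 /c /m/=.
  rewrite /cintegral -/(feature_mean phi (p nu) z) -/(feature_mean phi (n nu) z).
  rewrite -[\int[mu]_x _]/(feature_mean phi mu z).
  rewrite -(fineK fp) -(fineK fn) -(fineK fm) -!EFinB abse_EFin -EFinM.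
  rewrite -expr2 real_normK ?num_real//.
  by congr (_ ^+ _)%:E; ring.
rewrite (integral_feature_mean_sqr mk phi_bnd).
rewrite !big_ord_recl !big_ord0 /c /m/= !gram_enE -!EFinM -!EFinD; congr _%:E.
rewrite (gram_enC (n nu) (p nu)) (gram_enC mu (p nu)) (gram_enC mu (n nu)).
ring.
Qed.

(** By invariance the cross terms with mu add up to -2 I(mu) (nu^+(T) - nu^-(T)),
    which is -2 I(mu) because nu has mass 1. *)
Lemma energy_sub_discrepancy nu : invariant_measure K mu -> nu setT = 1 ->
  energy K nu - energy K (charge_of_finite_measure mu) = L2_discrepancy k mu nu.
Proof.
move=> inv nu1; rewrite energy_charge// energy_mu discrepancy_gram -EFinB; congr _%:E.
rewrite (gram_enC (n nu) (p nu)) (invariant_gram_en (p nu) inv).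
rewrite (invariant_gram_en (n nu) inv) (charge_setT nu1); ring.
Qed.

Lemma energy_empirical N (z : 'I_N -> Omega) : (forall x y, K x y = K y x) ->
  energy K (empirical z) = (discrete_energy K z)%:E.
Proof.
move=> K_sym; have potE : potential K (empirical z) =
    EFin \o (fun x => N%:R^-1 * \sum_j K x (z j))%R.
  by apply/funext => x; rewrite /potential (cintegral_empirical z (measurable_kernel x)).
rewrite /energy potE cintegral_empirical.
  by rewrite /discrete_energy -mulr_sumr mulrA -expr2 exprVn.
apply: measurable_funM => //; apply: measurable_sum => j.
under eq_fun do rewrite K_sym.
exact: measurable_kernel.
Qed.
End main.

Theorem theorem5p1 (R : realType) (Omega : pmetricType R)
  (Omega_compact : compact [set: Omega])
  (K : Omega -> Omega -> R) (K_kernel : is_kernel K)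
  (C : R) (KC_posdef : positive_definite (fun x y => (K x y + C)%R))
  (mu : probability (borel Omega) R)
  (mu_invariant : invariant_measure K mu)
  (mu_supp : msupport mu = [set: Omega])
  (k : Omega -> Omega -> R)
  (k_L2 : (fun p : borel Omega * borel Omega => k p.1 p.2) \in Lfun (mu \x mu) 2%:E)
  (k_sym : forall x y, k x y = k y x)
  (k_root : forall x y, (K x y + C)%:E = \int[mu]_z (k x z * k z y)%:E) :
  (forall nu : {charge set (borel Omega) -> \bar R}, normalized_charge nu ->
     energy K nu - energy K (charge_of_finite_measure mu) = L2_discrepancy k mu nu) /\
  (forall (N : nat) (z : 'I_N -> Omega), (0 < N)%N ->
     (discrete_energy K z)%:E - energy K (charge_of_finite_measure mu) =
     L2_discrepancy k mu (empirical z)).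
Proof.
have mk : measurable_fun setT (fun p : borel Omega * borel Omega => k p.1 p.2).
  by have := sub_Lfun_mfun k_L2; rewrite inE.
have [B K_bnd] := kernel_diag_bounded Omega_compact K_kernel.
have KC_bnd x : (K x x + C <= B + C)%R by rewrite lerD2r.
split=> [nu [_ nu1]|N z N0].
  exact: (energy_sub_discrepancy mk k_sym k_root KC_bnd).
rewrite -(energy_empirical mk k_sym k_root KC_bnd z K_kernel.2).
apply: (energy_sub_discrepancy mk k_sym k_root KC_bnd) => //.
exact: empirical_setT.
Qed.
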